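(* Assume that for every $t\ge0$ the sequence of distributions $\lambda^{(N)}_t=\frac1N\sum_{i=1}^N\delta_{\rho^{(N)}_i((0,t])}$, $N\in\mathbb{N}$, on $\mathbb{R}_+$ converges weakly as $N\to\infty$ to a probability distribution $\lambda_t$, and that $\lambda_t$ is continuous in $t$ with respect to the topology of weak convergence. Then for almost all $\omega\in\Omega$, the function $t\mapsto Y^{(N)}_C(\omega)(t)$, $t\in\mathbb{R}_+$, defined by $$Y^{(N)}_C(t)=\frac1N\sum_{i=1}^N\mathbf{1}_{\{\tau^{(N)}_{i,1}\le t\}},$$ converges pointwise in $t$ as $N\to\infty$ to the deterministic function $y_C:\mathbb{R}_+\to[0,1)$ defined by $$y_C(t)=1-\int_0^\infty e^{-s}\,\lambda_t(ds).$$
   Context: $\mathbb{R}_+=[0,\infty)$, and $\delta_c$ denotes the unit point mass at $c$. For each positive integer $N$, $\nu^{(N)}_1,\dots,\nu^{(N)}_N$ are independent Poisson random measures on $\mathbb{R}_+$, defined on a probability space $(\Omega,\mathcal F,\mathrm P)$, with intensity measures $\rho^{(N)}_i$, i.e. $\mathrm E[\nu^{(N)}_i(A)]=\rho^{(N)}_i(A)$ for Borel $A\subset\mathbb{R}_+$. Each $\rho^{(N)}_i$ is a Radon measure on $\mathbb{R}_+$ and is continuous: $\rho^{(N)}_i(\{t\})=0$ for all $t\ge0$. As part of the setting, with probability $1$, $\nu^{(N)}_i=\sum_{j=1}^\infty\delta_{\tau^{(N)}_{i,j}}$ with $0<\tau^{(N)}_{i,1}<\tau^{(N)}_{i,2}<\cdots$,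 and $\tau^{(N)}_{i,j}\ne\tau^{(N)}_{i',j'}$ if $(i,j)\neq(i',j')$. *)

(* Defs.v *)
From HB Require Import structures.
From mathcomp Require Export all_boot all_order all_algebra.
From mathcomp Require Export all_classical all_reals all_analysis.
From mathcomp Require Export measurable_realfun.
Export Order.TTheory GRing.Theory Num.Theory numFieldNormedType.Exports.
Set Implicit Arguments.
Unset Strict Implicit.
Unset Printing Implicit Defensive.
Local Open Scope classical_set_scope.
Local Open Scope ring_scope.

(* Measures on R_+ are encoded as Borel measures on R that do not charge
   the negative reals. *)
Definition halfline (R : realType) : set R := `[0, +oo[%classic.
Arguments halfline : clear implicits.

Definition carried_by_halfline (R : realType) (m : {measure set R -> \bar R}) :=
  m (~` halfline R) = 0%E.

Definition radon (R : realType) (m : {measure set R -> \bar R}) :=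
  (forall K : set R, compact K -> (m K < +oo)%E) /\
  (forall A : set R, measurable A ->
     m A = ereal_sup [set m K | K in [set K : set R | compact K /\ K `<=` A]]).

(* Mutual independence of a finite family of sets of events. *)
Definition independent (R : realType) (d : measure_display)
    (Omega : measurableType d) (P : probability Omega R) (I : finType)
    (F : I -> set (set Omega)) :=
  forall (J : {set I}) (E : I -> set Omega),
    (forall i, i \in J -> F i (E i)) ->
    P (\bigcap_(i in [set` J]) E i) = (\prod_(i in J) P (E i))%E.

Section random_measures.
Context (R : realType) (d d' : measure_display).
Context (Omega : measurableType d) (T : measurableType d').

(* The sigma-algebra generated by the random variable nu(A). *)
Definition sigma_value (nu : R.-ker Omega ~> T) (A : set T) :
    set (set Omega) :=
  preimage_set_system setT (fun w => nu w A) measurable.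

(* The sigma-algebra generated by the random measure nu. *)
Definition sigma_random_measure (nu : R.-ker Omega ~> T) : set (set Omega) :=
  <<s \bigcup_(A in measurable) sigma_value nu A >>.

(* The second argument of poisson_prob is a dummy: its body ignores it. The law
   poisson_prob 0 _ is the point mass at 0, as it should be (whereas
   poisson_pmf 0 k is 1 for every k, and cannot be used here). *)
Definition poisson_random_measure (P : probability Omega R)
    (rho : {measure set T -> \bar R}) (nu : R.-ker Omega ~> T) :=
  [/\ forall A, measurable A -> (rho A < +oo)%E ->
        forall k : nat, P [set w | nu w A = (k%:R)%:E] =
                        poisson_prob (fine (rho A)) 0 [set k],
      forall A, measurable A -> rho A = +oo%E ->
        {ae P, forall w, nu w A = +oo%E} &
      forall (n : nat) (A : 'I_n -> set T), (forall k, measurable (A k)) ->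
        trivIset setT A -> independent P (fun k => sigma_value nu (A k))].

End random_measures.

Section empirical.
Context (R : realType) (d : measure_display) (T : measurableType d).
Context (N : nat) (x : 'I_N -> T).

Definition sum_dirac (A : set T) : \bar R := (\sum_(i < N) \d_(x i) A)%E.

Let sum_dirac0 : sum_dirac set0 = 0%E.
Proof. by rewrite /sum_dirac big1// => i _; rewrite measure0. Qed.

Let sum_dirac_ge0 A : (0 <= sum_dirac A)%E.
Proof. exact: sume_ge0. Qed.

Let sum_dirac_sigma_additive : semi_sigma_additive sum_dirac.
Proof.
move=> F mF tF mUF; rewrite [X in X @ _ --> _](_ : _ =
    (fun n => \sum_(i < N) \sum_(0 <= k < n) \d_(x i) (F k))%E); last first.
  by apply/funext => n; rewrite exchange_big.
apply: cvg_nnesum => [i _|i _]; last first.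
  exact: measure_semi_sigma_additive.
by apply: nearW => n; exact: sume_ge0.
Qed.

HB.instance Definition _ := isMeasure.Build _ _ _ sum_dirac
  sum_dirac0 sum_dirac_ge0 sum_dirac_sigma_additive.

(* (1/N) * \sum_(i < N) \d_(x i), the zero measure if N = 0. *)
Definition empirical : {measure set T -> \bar R} :=
  mscale (N%:R^-1)%:nng sum_dirac.

End empirical.

(* Weak convergence of measures on R_+: the test functions are the bounded
   continuous functions on R_+ (no condition outside R_+). *)
Definition weakly_cvg (R : realType) (I : Type) (F : set_system I)
    (mu : I -> {measure set R -> \bar R}) (l : {measure set R -> \bar R}) :=
  forall f : R -> R,
    {within halfline R, continuous f} ->
    (exists M : R, forall x, halfline R x -> `|f x| <= M) ->
    \int[mu i]_(x in halfline R) f x @[i --> F] --> \int[l]_(x in halfline R) f x.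

(* The points of the i-th process are tau i 0 < tau i 1 < ..., so that
   tau i 0 is its first point. *)
Definition Y_C (R : realType) (Omega : Type) (N : nat)
    (tau : 'I_N -> nat -> Omega -> R) (w : Omega) (t : R) : R :=
  N%:R^-1 * \sum_(i < N) (tau i 0%N w <= t)%R%:R.

Definition y_C (R : realType) (lambda : R -> probability R R) (t : R) : R :=
  1 - \int[lambda t]_(s in halfline R) expR (- s).

(* Main.v *)
(* At a fixed time t, the events {nu_i ((0,t]) <> 0} are independent with
   probabilities 1 - exp (- rho_i ((0,t])), and almost surely they are the
   events {tau_{i,1} <= t}. Chernoff's bound and Borel-Cantelli show that the
   frequency of these events is almost surely asymptotic to its mean, which
   tends to y_C(t) because exp (- s) is a bounded continuous test function.
   This holds simultaneously for all rational t; as Y_C is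
   nondecreasing in t and y_C is continuous, it extends to every t. *)
From mathcomp Require Import ring lra.
Require Import Defs.
Set Implicit Arguments.
Unset Strict Implicit.
Unset Printing Implicit Defensive.
Local Open Scope classical_set_scope.
Local Open Scope ring_scope.

(** * Chernoff bound for independent Bernoulli trials *)

(* Invert [1 - x <= exp (- x)] and use [1 <= (1 + x + 2 x^2) (1 - x)]. *)
Lemma expR_le_quadratic (R : realType) (x : R) :
  x <= 2^-1 -> expR x <= 1 + x + 2 * x ^+ 2.
Proof.
move=> x2; have x1 : 0 < 1 - x by lra.
have : (1 - x) * expR x <= 1.
  rewrite -[leRHS](expRxMexpNx_1 x) mulrC ler_pM2l ?expR_gt0//.
  exact: expR_ge1Dx.
have : 1 <= (1 - x) * (1 + x + 2 * x ^+ 2).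
  have : 0 <= x ^+ 2 * (1 - 2 * x) by rewrite mulr_ge0 ?sqr_ge0//; lra.
  lra.
by move=> h1 h2; rewrite -(ler_pM2l x1); exact: le_trans h1.
Qed.

(** After the quadratic bound on both exponentials, the terms linear in [s] cancel and the squares
    add up to [2 * s ^+ 2 * p * (1 - p)]. *)
Lemma bernoulli_mgf_le (R : realType) (p s : R) :
  0 <= p <= 1 -> `|s| <= 2^-1 ->
  p * expR (s * (1 - p)) + (1 - p) * expR (- (s * p)) <= expR (2 * s ^+ 2).
Proof.
move=> /andP[p0 p1]; rewrite ler_norml => /andP[s1 s2].
apply: (@le_trans _ _ (1 + 2 * s ^+ 2)); last exact: expR_ge1Dx.
have h1 : expR (s * (1 - p)) <= 1 + s * (1 - p) + 2 * (s * (1 - p)) ^+ 2.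
  by apply: expR_le_quadratic; nra.
have h2 : expR (- (s * p)) <= 1 + - (s * p) + 2 * (- (s * p)) ^+ 2.
  by apply: expR_le_quadratic; nra.
have p1' : 0 <= 1 - p by lra.
apply: (le_trans (lerD (ler_wpM2l p0 h1) (ler_wpM2l p1' h2))).
have : 0 <= s ^+ 2 * (1 - p * (1 - p)) by rewrite mulr_ge0 ?sqr_ge0//; nra.
lra.
Qed.

Section finite_bernoulli.
Context (R : realType) (I : finType) (p : I -> R).
Hypothesis p01 : forall i, 0 <= p i <= 1.

(** The law of the random set of successes in independent trials with success probabilities
    [p i]. *)
Definition bernoulli_weight (J : {set I}) : R :=
  \prod_i (if i \in J then p i else 1 - p i).

Definition deviation (J : {set I}) : R := \sum_i ((i \in J)%:R - p i).

Lemma bernoulli_weight_ge0 J : 0 <= bernoulli_weight J.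
Proof.
apply: prodr_ge0 => i _; have /andP[? ?] := p01 i.
by case: ifP; rewrite ?subr_ge0.
Qed.

(** By independence the moment generating function factorises: expanding the product of the
    one-trial factors gives the sum over success sets [J]. *)
Lemma mgf_deviation_le s : `|s| <= 2^-1 ->
  \sum_(J : {set I}) bernoulli_weight J * expR (s * deviation J)
    <= expR (2 * s ^+ 2 * #|I|%:R).
Proof.
move=> s2.
have -> : \sum_(J : {set I}) bernoulli_weight J * expR (s * deviation J) =
    \prod_i (p i * expR (s * (1 - p i)) + (1 - p i) * expR (- (s * p i))).
  rewrite bigA_distr; apply: eq_bigr => J _.
  rewrite /deviation mulr_sumr expR_sum -big_split/=; apply: eq_bigr => i _.
  by case: ifP => _ //=; rewrite sub0r mulrN.
apply: (@le_trans _ _ (\prod_(i : I) expR (2 * s ^+ 2))).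
  apply: ler_prod => i _; rewrite bernoulli_mgf_le// andbT.
  by have /andP[? ?] := p01 i; rewrite addr_ge0 ?mulr_ge0 ?expR_ge0 ?subr_ge0.
by rewrite prodr_const expRM_natr.
Qed.

(* Chernoff's method with exponent [e / 4]. *)
Lemma deviation_tail_le e : 0 <= e <= 2 ->
  \sum_(J : {set I} | e * #|I|%:R <= `|deviation J|) bernoulli_weight J
    <= 2 * expR (- (e ^+ 2 / 8)) ^+ #|I|.
Proof.
(* This [s] minimises [2 * s ^+ 2 - s * e], with minimum [- (e ^+ 2 / 8)]; the bound [e <= 2]
   ensures [s <= 2^-1]. *)
move=> /andP[e0 e2]; set s := e / 4; set n := #|I|%:R : R.
have s2 : `|s| <= 2^-1 by rewrite ger0_norm /s; lra.
have sN2 : `|- s| <= 2^-1 by rewrite normrN.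
pose c := expR (- (s * (e * n))).
have c0 : 0 <= c by exact: expR_ge0.
(* Adding the tilts by [s] and [- s] treats both tails at once, whence the factor 2. *)
pose g J := bernoulli_weight J * expR (s * deviation J)
  + bernoulli_weight J * expR (- s * deviation J).
have g0 J : 0 <= g J.
  by rewrite addr_ge0// mulr_ge0 ?expR_ge0 ?bernoulli_weight_ge0.
apply: (@le_trans _ _ (\sum_(J : {set I}) c * g J)).
  rewrite big_mkcond/=; apply: ler_sum => J _; case: ifP => [dev|_]; last first.
    by rewrite mulr_ge0.
  rewrite /g -mulrDr mulrCA ler_peMr ?bernoulli_weight_ge0// mulrDr -!expRD.
  have s0 : 0 <= s by rewrite /s; lra.
  move: dev; rewrite ler_normr => /orP[] dev.
    apply: ler_wpDr; rewrite ?expR_ge0//.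
    by rewrite -(expR0 R) ler_expR; have := ler_wpM2l s0 dev; lra.
  apply: ler_wpDl; rewrite ?expR_ge0//.
  by rewrite -(expR0 R) ler_expR; have := ler_wpM2l s0 dev; lra.
rewrite -mulr_sumr big_split/=.
apply: (le_trans (ler_wpM2l c0 (lerD (mgf_deviation_le s2) (mgf_deviation_le sN2)))).
rewrite sqrrN -expRM_natr -/n.
rewrite [leLHS](_ : _ = 2 * (c * expR (2 * s ^+ 2 * n))); last by ring.
by rewrite ler_pM2l// -expRD ler_expR /s; lra.
Qed.

End finite_bernoulli.

(** * Large deviations of finitely many independent events *)

Lemma measure_bigsetU_le (R : realType) (d : measure_display)
    (T : measurableType d) (mu : {measure set T -> \bar R}) (I : Type)
    (r : seq I) (Q : pred I) (A : I -> set T) :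
  (forall i, measurable (A i)) ->
  (mu (\big[setU/set0]_(i <- r | Q i) A i) <= \sum_(i <- r | Q i) mu (A i))%E.
Proof.
(* Measurability is carried through the induction because binary subadditivity requires it. *)
move=> mA; pose K X (x : \bar R) := measurable X /\ (mu X <= x)%E.
suff [] : K (\big[setU/set0]_(i <- r | Q i) A i) (\sum_(i <- r | Q i) mu (A i))%E by [].
apply: (big_ind2 K) => [|X x Y y [mX Xx] [mY Yy]|i _].
- by split => //; rewrite measure0.
- split; first exact: measurableU.
  by apply: le_trans (leeD Xx Yy); exact: measureU2.
- by split.
Qed.

Section independent_events.
Context (R : realType) (d : measure_display) (Omega : measurableType d).
Context (P : probability Omega R) (I : finType) (B : I -> set Omega).
Hypothesis mB : forall i, measurable (B i).
Hypothesis indepB : independent P (fun i => [set B i; ~` B i]).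

Let p i : R := fine (P (B i)).

Let PE i : P (B i) = (p i)%:E.
Proof. by rewrite /p fineK// fin_num_measure. Qed.

(** The event that exactly the [B i] with [i] in [J] occur, written as an intersection over the full
    index set to match [independent]. *)
Definition atom (J : {set I}) : set Omega :=
  \bigcap_(i in [set` [set: I]%SET]) (if i \in J then B i else ~` B i).

Lemma measurable_atom J : measurable (atom J).
Proof.
apply: fin_bigcap_measurable => // i _.
by case: ifP => _ //; exact: measurableC.
Qed.

Lemma probability_atom J : P (atom J) = (bernoulli_weight p J)%:E.
Proof.
rewrite /atom indepB => [|i _]; last by case: ifP => _ /=; [left|right].
rewrite /bernoulli_weight -prodEFin; apply: eq_big => [i|i _]; first by rewrite inE.
by case: ifP => _; rewrite ?probability_setC// PE.
Qed.

Lemma sum_indic_deviation J w : atom J w ->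
  \sum_i (\1_(B i) w - p i) = deviation p J.
Proof.
move=> Jw; apply: eq_bigr => i _; congr (_ - _).
have /= := Jw i; rewrite inE => /(_ isT).
by rewrite indicE; case: ifP => _ Bw; [rewrite mem_set|rewrite memNset].
Qed.

Definition large_deviation (e : R) : set Omega :=
  [set w | e * #|I|%:R <= `|\sum_i (\1_(B i) w - p i)|].

(** The deviation is constant on each atom, and every [w] lies in the atom of the set of indices
    whose events contain it. *)
Lemma large_deviationE e : large_deviation e =
  \big[setU/set0]_(J : {set I} | e * #|I|%:R <= `|deviation p J|) atom J.
Proof.
rewrite -(bigcup_pred [pred J | e * #|I|%:R <= `|deviation p J|]).
apply/seteqP; split=> [w Bw|w [J /= Jdev Jw]]; last first.
  by rewrite /large_deviation/= (sum_indic_deviation Jw).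
pose J := [set i | w \in B i]%SET.
have Jw : atom J w.
  move=> i _; rewrite inE; case: ifPn; first by move/set_mem.
  by move=> /negP h; rewrite /setC/= => Bw'; apply: h; rewrite mem_set.
by exists J => //; rewrite /= inE/= -(sum_indic_deviation Jw).
Qed.

Lemma measurable_large_deviation e : measurable (large_deviation e).
Proof.
by rewrite large_deviationE; apply: bigsetU_measurable => J _; exact: measurable_atom.
Qed.

Lemma large_deviation_le e : 0 <= e <= 2 ->
  (P (large_deviation e) <= (2 * expR (- (e ^+ 2 / 8)) ^+ #|I|)%:E)%E.
Proof.
move=> e02; rewrite large_deviationE.
apply: (le_trans (measure_bigsetU_le _ _ _ measurable_atom)).
rewrite (eq_bigr _ (fun J _ => probability_atom J)).
rewrite sumEFin lee_fin; apply: deviation_tail_le => // i.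
by rewrite -!lee_fin -PE measure_ge0 probability_le1.
Qed.

End independent_events.

(** * Borel-Cantelli and a strong law for triangular arrays *)

Lemma nneseries_geometric_lty (R : realType) (u : (\bar R)^nat) (c x : R) :
  0 <= c -> 0 < x < 1 -> (forall n, (0 <= u n)%E) ->
  (forall n, (u n <= (c * x ^+ n)%:E)%E) -> (\sum_(0 <= n <oo) u n < +oo)%E.
Proof.
move=> c0 /andP[x0 x1] u0 ux.
apply: (@le_lt_trans _ _ (c / (1 - x))%:E); last exact: ltry.
apply: lime_le; first exact: is_cvg_nneseries.
apply: nearW => n; apply: (@le_trans _ _ (series (geometric c x) n)%:E).
  by rewrite /series/= -sumEFin; apply: lee_sum.
by rewrite lee_fin; apply: geometric_le_lim => //; rewrite ger0_norm ?ltW.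
Qed.

(* Large deviations of fixed size have summable probabilities, so Borel-Cantelli
   applies without any relation between different rows. *)
Lemma triangular_strong_law (R : realType) (d : measure_display)
    (Omega : measurableType d) (P : probability Omega R)
    (B : forall N : nat, 'I_N -> set Omega) :
  (forall N i, measurable (B N i)) ->
  (forall N, independent P (fun i => [set B N i; ~` B N i])) ->
  {ae P, forall w, N%:R^-1 * \sum_(i < N) (\1_(B N i) w - fine (P (B N i)))
    @[N --> \oo] --> (0 : R)}.
Proof.
move=> mB indB.
(* Countably many thresholds tending to 0, so that the exceptional null sets can be united. *)
pose e (k : nat) : R := k.+1%:R^-1.
have e01 k : 0 < e k <= 1 by rewrite /e invr_gt0 ltr0n/= invf_le1 ?ler1n.
pose F k N := large_deviation P (B N) (e k).
have mF k N : measurable (F k N) by exact: measurable_large_deviation.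
have F0 k : P (lim_sup_set (F k)) = 0%E.
  have /andP[ek0 ek1] := e01 k.
  apply: lim_sup_set_cvg0 => //.
  apply: (@nneseries_geometric_lty _ _ 2 (expR (- (e k ^+ 2 / 8)))) => //.
    rewrite expR_gt0 expR_lt1 oppr_lt0 divr_gt0//; exact: exprn_gt0.
  move=> N; apply: (le_trans (large_deviation_le _ _ _)) => //.
    by rewrite ltW//=; apply: le_trans ek1 _; rewrite ler1n.
  by rewrite card_ord.
have : {ae P, forall w, forall k, ~ lim_sup_set (F k) w}.
  apply: ae_foralln => k; exists (lim_sup_set (F k)); split; last 2 first.
  - exact: F0.
  - by move=> w /= /contrapT.
  by apply: bigcapT_measurable => n; apply: bigcup_measurable => m _; exact: mF.
apply: filterS => w Fw; apply/cvgrPdist_lt => eps eps0.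
have [k ke] : exists k, e k < eps.
  have [k _ /(_ k (leqnn k)) /= kP] := near_infty_natSinv_lt (PosNum eps0).
  by exists k.
(* Outside the limsup set, [w] belongs to only finitely many [F k N]. *)
have [n nF] : exists n, forall N, (n <= N)%N -> ~ F k N w.
  apply: contrapT => nF; apply: (Fw k) => n _; apply: contrapT => FN.
  by apply: nF; exists n => N nN FkN; apply: FN; exists N.
near=> N; rewrite sub0r normrN normrM.
have N0 : 0 < N%:R :> R by rewrite ltr0n; near: N; exact: nbhs_infty_gt.
rewrite gtr0_norm ?invr_gt0// mulrC ltr_pdivrMr//.
apply: (@lt_trans _ _ (e k * N%:R)); last by rewrite ltr_pM2r.
rewrite ltNge; apply/negP; have := nF N; rewrite /F /large_deviation/= card_ord.
by apply; near: N; exact: nbhs_infty_ge.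
Unshelve. all: by end_near. Qed.

(** * From rational times to all times *)

(** Monotonicity squeezes [Y N t] between the values at rationals [q1 <= t <= q2] close to [t], both
    eventually within [e] of [y t]. *)
Lemma nondecreasing_cvg_from_rat (R : realType) (Y : nat -> R -> R) (y : R -> R) :
  (forall N, {homo Y N : s t / s <= t}) ->
  (forall t : R, 0 <= t -> y s @[s --> within (halfline R) (nbhs t)] --> y t) ->
  (forall q : rat, 0 <= (ratr q : R) ->
    Y N (ratr q) @[N --> \oo] --> y (ratr q)) ->
  forall t : R, 0 <= t -> Y N t @[N --> \oo] --> y t.
Proof.
move=> Ymono ycont Yrat t t0; apply/cvgrPdist_lt => e e0.
have e2 : 0 < e / 2 by lra.
have /cvgrPdist_lt/(_ _ e2) := ycont _ t0.
rewrite near_withinE => /nbhs_ballP[r /= r0 yr].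
have yball s : 0 <= s -> `|t - s| < r -> `|y t - y s| < e / 2.
  by move=> s0 ts; apply: yr => //; rewrite /halfline/= in_itv/= s0.
have Yball (q : rat) : 0 <= (ratr q : R) -> `|t - ratr q| < r ->
    \forall N \near \oo, `|y t - Y N (ratr q)| < e.
  move=> q0 /(yball _ q0) tq; have /cvgrPdist_lt/(_ _ e2) := Yrat _ q0.
  apply: filterS => N qN; rewrite -(subrK (y (ratr q)) (y t)) -addrA.
  by apply: le_lt_trans (ler_normD _ _) _; lra.
have [q1 [q10 q1t q1r]] : exists q : rat,
    [/\ 0 <= (ratr q : R), (ratr q : R) <= t & `|t - ratr q| < r].
  (* At [t = 0] there is no nonnegative rational strictly below [t], so [q1] is 0 itself. *)
  move: t0; rewrite le_eqVlt => /predU1P[<-|t0].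
    by exists 0; rewrite rmorph0 subrr normr0.
  have : Num.max 0 (t - r) < t by rewrite gt_max t0/=; lra.
  move=> /rat_in_itvoo[q]; rewrite in_itv/= gt_max => /andP[/andP[q0 qr] qt].
  by exists q; split; [exact: ltW|exact: ltW|rewrite ger0_norm; lra].
have [q2 [tq2 q2r]] : exists q : rat, t <= (ratr q : R) /\ `|t - ratr q| < r.
  have : t < t + r by lra.
  move=> /rat_in_itvoo[q]; rewrite in_itv/= => /andP[tq qr].
  by exists q; split; [exact: ltW|rewrite ler0_norm; lra].
have q20 : 0 <= (ratr q2 : R) by exact: le_trans tq2.
have N1 := Yball _ q10 q1r; have N2 := Yball _ q20 q2r.
near=> N.
have : `|y t - Y N (ratr q1)| < e by near: N.
have : `|y t - Y N (ratr q2)| < e by near: N.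
have := Ymono N _ _ q1t; have := Ymono N _ _ tq2.
by rewrite !ltr_norml => ? ? /andP[? ?] /andP[? ?]; apply/andP; split; lra.
Unshelve. all: by end_near. Qed.

(** * Integrals of [expR (- s)] against empirical and limit measures *)

Lemma Rintegral_empirical (R : realType) (N : nat) (x : 'I_N -> R) (D : set R)
    (f : R -> R) : measurable D -> measurable_fun setT f ->
  (forall s, 0 <= f s) -> (forall i, D (x i)) ->
  \int[empirical R x]_(s in D) f s = N%:R^-1 * \sum_(i < N) f (x i).
Proof.
move=> mD mf f0 Dx.
have mEf : measurable_fun D (EFin \o f).
  by apply: measurable_funTS; exact/measurable_EFinP.
rewrite /Rintegral ge0_integral_mscale//=; last by move=> s _; rewrite lee_fin.
(* [msum] takes a family indexed by [nat]; the default point 0 is never reached, since only [k < N]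
   is summed. *)
pose m (k : nat) : {measure set R -> \bar R} := \d_(oapp x 0 (insub k)).
rewrite (@eq_measure_integral _ _ _ _ (msum m N)); last first.
  move=> A _ _; rewrite /sum_dirac /msum; apply: eq_bigr => i _.
  by rewrite /m valK.
rewrite ge0_integral_measure_sum//; last by move=> s _; rewrite lee_fin.
rewrite (eq_bigr (fun i => (f (x i))%:E)) => [|i _].
  by rewrite sumEFin -EFinM.
by rewrite /m valK/= integral_dirac// diracE mem_set ?mul1e.
Qed.

Section exponential_integral.
Context (R : realType).

Let f (s : R) := expR (- s).

Lemma continuous_expRN : continuous f.
Proof.
move=> s; apply: (@continuous_comp _ _ _ -%R expR); first exact: opp_continuous.
exact: continuous_expR.
Qed.

Lemma measurable_expRN : measurable_fun setT f.
Proof. exact: continuous_measurable_fun continuous_expRN. Qed.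

Lemma measurable_halfline : measurable (halfline R).
Proof. exact: measurable_itv. Qed.

Lemma weakly_cvg_expRN (I : Type) (F : set_system I)
    (mu : I -> {measure set R -> \bar R}) (l : {measure set R -> \bar R}) :
  weakly_cvg F mu l ->
  \int[mu i]_(s in halfline R) f s @[i --> F] --> \int[l]_(s in halfline R) f s.
Proof.
apply; first by apply: continuous_subspaceT; exact: continuous_expRN.
exists 1 => s; rewrite /halfline/= in_itv/= andbT => s0.
by rewrite ger0_norm ?expR_ge0// /f -(expR0 R) ler_expR oppr_le0.
Qed.

(** The integrand is at most 1 on a set of mass 1. Were the integral 0, this positive integrand
    would vanish almost everywhere, making the half-line null. These bounds place [y_C] in
    [[0, 1)]. *)
Lemma Rintegral_expRN_gt0_le1 (l : probability R R) :
  carried_by_halfline l -> 0 < \int[l]_(s in halfline R) f s <= 1.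
Proof.
move=> l0; have mH := measurable_halfline.
have lH : l (halfline R) = 1%E.
  by rewrite -[halfline R]setCK probability_setC ?l0 ?sube0//; exact: measurableC.
have mEf : measurable_fun (halfline R) (EFin \o f).
  by apply: measurable_funTS; apply/measurable_EFinP; exact: measurable_expRN.
have If1 : (\int[l]_(s in halfline R) (f s)%:E <= 1)%E.
  rewrite -[leRHS](_ : \int[l]_(s in halfline R) (cst 1%E s) = 1)%E; last first.
    by rewrite integral_cst// mul1e; exact: lH.
  apply: ge0_le_integral => //.
  - by move=> s _; rewrite lee_fin expR_ge0.
  - move=> s; rewrite /halfline/= in_itv/= andbT => s0.
    by rewrite lee_fin /f -(expR0 R) ler_expR oppr_le0.
have If0 : (0 <= \int[l]_(s in halfline R) (f s)%:E)%E.
  by apply: integral_ge0 => s _; rewrite lee_fin expR_ge0.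
have Iffin : (\int[l]_(s in halfline R) (f s)%:E)%E \is a fin_num.
  by rewrite ge0_fin_numE//; apply: le_lt_trans If1 _; exact: ltry.
apply/andP; split; last by rewrite -lee_fin fineK.
rewrite lt_neqAle fine_ge0// andbT eq_sym; apply/eqP => I0.
have : ae_eq l (halfline R) (EFin \o f) (cst 0%E).
  apply/ae_eq_integral_abs => //=.
  transitivity (\int[l]_(s in halfline R) (f s)%:E)%E.
    by apply: eq_integral => s _; rewrite /= ger0_norm// expR_ge0.
  by rewrite -(fineK Iffin) [fine _]I0.
move=> [A [mA A0 HA]]; have : (l (halfline R) <= l A)%E.
  apply: le_measure; rewrite ?inE// => s Hs; apply: HA => /= /(_ Hs).
  by move=> /eqP; rewrite eqe gt_eqF// expR_gt0.
by rewrite lH A0 lee_fin ler10.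
Qed.

End exponential_integral.

(** * First points and the events of charging []0, t]] *)

(** As [u] increases, []0, t]] is free of points as soon as it misses the smallest one, [u 0], which
    is positive. *)
Lemma sum_dirac_itv_eq0 (R : realType) (u : nat -> R) (t : R) :
  0 < u 0%N -> (forall j, u j < u j.+1) ->
  (\sum_(0 <= j <oo) \d_(u j) `]0%R, t]%classic == 0 :> \bar R)%E = ~~ (u 0%N <= t).
Proof.
move=> u0 uS; have u0j j : u 0%N <= u j.
  by elim: j => // j /le_trans; apply; exact: ltW.
rewrite -ltNge; apply/idP/idP => [|tu].
  apply: contraTT; rewrite -leNgt => ut.
  rewrite gt_eqF// (@lt_le_trans _ _ (\d_(u 0%N) `]0, t]%classic))//.
    by rewrite diracE mem_set ?lte_fin ?ltr01//= in_itv/= u0.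
  by rewrite (nneseriesD1 (n := 0%N))//= leeDl// nneseries_ge0.
apply/eqP; rewrite eseries0// => j _ _; rewrite diracE memNset//= in_itv/=.
by apply/negP; rewrite negb_and orbC -ltNge (lt_le_trans tu).
Qed.

Lemma radon_itv_fin_num (R : realType) (m : {measure set R -> \bar R}) (t : R) :
  radon m -> m `]0, t]%classic \is a fin_num.
Proof.
move=> [mK _]; rewrite ge0_fin_numE//.
apply: le_lt_trans (mK _ (@segment_compact R 0 t)).
by apply: le_measure; rewrite ?inE//; apply: subset_itvr; rewrite bnd_simp.
Qed.

Section charged_interval.
Context (R : realType) (d : measure_display) (Omega : measurableType d).
Context (P : probability Omega R).

(** Almost surely this is the event that the first point is at most [t]; phrased through [nu], it
    inherits measurability and independence from the random measure. *)
Definition charged (nu : R.-ker Omega ~> R) (t : R) : set Omega :=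
  [set w | nu w `]0, t]%classic != 0%E].

Lemma chargedE (nu : R.-ker Omega ~> R) t :
  charged nu t = (fun w => nu w `]0, t]%classic) @^-1` (~` [set 0%E]).
Proof. by apply/seteqP; split=> w /eqP. Qed.

Lemma sigma_value_charged (nu : R.-ker Omega ~> R) t :
  sigma_value nu `]0, t]%classic (charged nu t).
Proof.
exists (~` [set 0%E]); first exact/measurableC/emeasurable_set1.
by rewrite setTI chargedE.
Qed.

Lemma sigma_value_chargedC (nu : R.-ker Omega ~> R) t :
  sigma_value nu `]0, t]%classic (~` charged nu t).
Proof.
exists [set 0%E]; first exact: emeasurable_set1.
by rewrite setTI chargedE -preimage_setC setCK.
Qed.

Lemma measurable_charged (nu : R.-ker Omega ~> R) t : measurable (charged nu t).
Proof.
rewrite chargedE -[X in measurable X]setTI.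
by apply: measurable_kernel => //; exact/measurableC/emeasurable_set1.
Qed.

Lemma independent_charged (I : finType) (nu : I -> R.-ker Omega ~> R) t :
  independent P (fun i => sigma_random_measure (nu i)) ->
  independent P (fun i => [set charged (nu i) t; ~` charged (nu i) t]).
Proof.
move=> ind J E JE; apply: ind => i iJ; apply: sub_sigma_algebra.
exists `]0, t]%classic => //.
by case: (JE i iJ) => ->; [exact: sigma_value_charged|exact: sigma_value_chargedC].
Qed.

(** The complement is the event of a zero count, whose Poisson probability is the exponential of
    minus the mean. *)
Lemma probability_charged (rho : {measure set R -> \bar R})
    (nu : R.-ker Omega ~> R) t :
  poisson_random_measure P rho nu -> rho `]0, t]%classic \is a fin_num ->
  fine (P (charged nu t)) = 1 - expR (- fine (rho `]0, t]%classic)).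
Proof.
move=> [pois _ _] rhofin.
have rho0 : 0 <= fine (rho `]0, t]%classic) by exact: fine_ge0.
have P0 : P (~` charged nu t) = (expR (- fine (rho `]0, t]%classic)))%:E.
  have -> : ~` charged nu t = [set w | nu w `]0, t]%classic = 0%:R%:E].
    apply/seteqP; split=> w /=; rewrite /charged/=.
      by move/negP/negPn/eqP.
    by move=> ->; rewrite eqxx.
  rewrite pois//; last by rewrite ltey_eq rhofin.
  (* Mean 0 is treated apart: there [poisson_prob] is the point mass at 0, in agreement with
     [expR 0 = 1]. *)
  move: rho0; rewrite /poisson_prob le_eqVlt => /predU1P[<-|rho0].
    by rewrite ltxx diracE mem_set// oppr0 expR0.
  rewrite rho0 esum_set1 ?lee_fin ?poisson_pmf_ge0//.
  by rewrite /poisson_pmf rho0 expr0 fact0 invr1 !mul1r.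
have := probability_setC P (measurableC (measurable_charged nu t)).
by rewrite setCK P0 => ->.
Qed.

End charged_interval.

(** * Range of the limit and almost sure convergence at all times *)

Theorem corollary1p2 (R : realType) (d : measure_display)
    (Omega : measurableType d) (P : probability Omega R)
    (rho : forall N : nat, 'I_N -> {measure set R -> \bar R})
    (nu : forall N : nat, 'I_N -> R.-ker Omega ~> R)
    (tau : forall N : nat, 'I_N -> nat -> Omega -> R)
    (lambda : R -> probability R R)
    (rho_carried : forall N (i : 'I_N), carried_by_halfline (rho N i))
    (rho_radon : forall N (i : 'I_N), radon (rho N i))
    (rho_continuous : forall N (i : 'I_N) (t : R), 0 <= t ->
       rho N i [set t] = 0%E)
    (nu_poisson : forall N (i : 'I_N),
       poisson_random_measure P (rho N i) (nu N i))
    (nu_independent : forall N,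
       independent P (fun i : 'I_N => sigma_random_measure (nu N i)))
    (nu_tau : forall N, {ae P, forall w : Omega,
       [/\ forall (i : 'I_N) (A : set R), measurable A ->
             nu N i w A = (\sum_(0 <= j <oo) \d_(tau N i j w) A)%E,
           forall i : 'I_N, 0 < tau N i 0%N w,
           forall (i : 'I_N) (j : nat), tau N i j w < tau N i j.+1 w &
           forall (i i' : 'I_N) (j j' : nat), (i, j) <> (i', j') ->
             tau N i j w <> tau N i' j' w]})
    (lambda_carried : forall t : R, 0 <= t -> carried_by_halfline (lambda t))
    (lambda_limit : forall t : R, 0 <= t ->
       weakly_cvg \oo
         (fun N => empirical R (fun i : 'I_N => fine (rho N i `]0, t]%classic)))
         (lambda t))
    (lambda_continuous : forall t : R, 0 <= t ->
       weakly_cvg (within (halfline R) (nbhs t)) (fun s : R => lambda s) (lambda t)) :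
  (forall t : R, 0 <= t -> 0 <= y_C lambda t < 1) /\
  {ae P, forall w : Omega, forall t : R, 0 <= t ->
     Y_C (tau N) w t @[N --> \oo] --> y_C lambda t}.
Proof.
split=> [t t0|].
  have /andP[I0 I1] := Rintegral_expRN_gt0_le1 (lambda_carried t t0).
  by rewrite /y_C subr_ge0 I1/= ltrBlDr ltrDl.
pose B (t : R) N (i : 'I_N) := charged (nu N i) t.
have PB t N (i : 'I_N) :
    fine (P (B t N i)) = 1 - expR (- fine (rho N i `]0, t]%classic)).
  by apply: probability_charged => //; exact: radon_itv_fin_num.
(* The mean frequency is 1 minus the integral of [expR (- s)] against the empirical measure, so weak
   convergence gives its limit. *)
have meanB t : 0 <= t ->
    N%:R^-1 * \sum_(i < N) fine (P (B t N i)) @[N --> \oo] --> y_C lambda t.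
  move=> t0; rewrite /y_C; set l := \int[_]_(s in _) _.
  pose a N (i : 'I_N) := fine (rho N i `]0, t]%classic).
  pose I N := \int[empirical R (@a N)]_(s in halfline R) expR (- s).
  have I_l : 1 - I N @[N --> \oo] --> 1 - l.
    by apply: cvgB; [exact: cvg_cst|exact: weakly_cvg_expRN (lambda_limit t t0)].
  (* The two sequences differ at [N = 0], where the empirical measure is zero: [1 - I 0] is 1 but
     the mean is 0. *)
  apply: cvg_trans I_l; apply: near_eq_cvg; near=> N; rewrite /I.
  have N0 : N%:R != 0 :> R by rewrite pnatr_eq0 -lt0n; near: N; exact: nbhs_infty_gt.
  rewrite (Rintegral_empirical (@measurable_halfline R) (@measurable_expRN R));
    last 2 first.
  - by move=> s; exact: expR_ge0.
  - by move=> i; rewrite /halfline/= in_itv/= andbT /a fine_ge0.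
  under [in RHS]eq_bigr do rewrite PB.
  rewrite sumrB mulrBr; congr (_ - _).
  by rewrite sumr_const card_ord mulVf.
(* An enumeration of the rationals by [nat], with value 0 at integers that code no rational, so that
   countably many null sets are discarded. *)
pose r n : R := ratr (odflt 0 (unpickle n)).
have slln : {ae P, forall w, forall n,
    N%:R^-1 * \sum_(i < N) (\1_(B (r n) N i) w - fine (P (B (r n) N i)))
      @[N --> \oo] --> (0 : R)}.
  apply: ae_foralln => n.
  apply: (@triangular_strong_law R d Omega P (B (r n))) => [N i|N].
    exact: measurable_charged.
  exact: independent_charged (nu_independent N).
have tauB := ae_foralln nu_tau.
move: slln tauB; apply: filterS2 => w wslln wtau.
apply: (@nondecreasing_cvg_from_rat R (fun N => Y_C (tau N) w)).
- move=> N s t st; rewrite /Y_C ler_wpM2l ?invr_ge0//; apply: ler_sum => i _.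
  by rewrite ler_nat; case: (leP (tau N i 0%N w) s) => // /le_trans/(_ st) ->.
- move=> t t0; rewrite /y_C; apply: cvgB; first exact: cvg_cst.
  exact: weakly_cvg_expRN (lambda_continuous t t0).
move=> q q0.
have rq : r (pickle q) = ratr q by rewrite /r pickleK.
have := wslln (pickle q); rewrite rq => wq.
(* [Y_C] is split into its centred fluctuation, which tends to 0, and its mean. *)
rewrite -[y_C _ _]add0r; apply: cvg_trans (cvgD wq (meanB _ q0)).
apply: near_eq_cvg; apply: nearW => N; rewrite /Y_C fctE -mulrDr -big_split/=.
congr (_ * _); apply: eq_bigr => i _.
rewrite subrK indicE; congr (_%:R); congr nat_of_bool.
have [nuE tau0 tauS _] := wtau N.
(* For this [w] the measure is the sum of the point masses at the [tau N i j w], so charging the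
   interval means that the first point has occurred. *)
have Bw : B (ratr q) N i w <-> tau N i 0%N w <= ratr q.
  by rewrite /B /charged/= nuE// sum_dirac_itv_eq0// negbK.
by apply/idP/idP => [/set_mem/Bw|/Bw/mem_set].
Unshelve. all: by end_near. Qed.
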